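(* Let $n\ge 1$, let $V$ be a set with $|V|=n$, and let $M\subseteq[n]$ with $l(M)=l$. Suppose that $\mathcal{A},\mathcal{B}\subseteq 2^V$ and that the pair $(\mathcal{A},\mathcal{B})$ is $M$-intersecting. Then $$|\mathcal{A}||\mathcal{B}|<2.631^n\cdot 10^{4l+10}.$$ Moreover, if $n$ is sufficiently large, then also $$|\mathcal{A}||\mathcal{B}|<2^{\,n+2l\log^2 n},$$ where $\log$ denotes the binary logarithm. That is, $|\mathcal{A}||\mathcal{B}|<\min\{2.631^n\cdot 10^{4l+10},\,2^{n+2l\log^2 n}\}$ for $n$ sufficiently large.
   Context: $[n]:=\{0,1,\ldots,n\}$. For a set $M$ of integers, $l(M)$ (the length of $M$) is the maximum number of consecutive integers contained in $M$. A pair $(\mathcal{A},\mathcal{B})$ of families of subsets of $V$ is $M$-intersecting if $|A\cap B|\in M$ for every $A\in\mathcal{A}$ and $B\in\mathcal{B}$. *)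

(* Defs.v *)
From mathcomp Require Import all_boot.
From Stdlib Require Import Reals.

Definition M_intersecting {V : finType} (M : pred nat) (A B : {set {set V}}) : Prop :=
  forall X Y : {set V}, X \in A -> Y \in B -> M #|X :&: Y|.

Definition length_is (M : pred nat) (l : nat) : Prop :=
  (exists a : nat, forall i : nat, (i < l)%N -> M (a + i)%N) /\
  (forall a k : nat, (forall i : nat, (i < k)%N -> M (a + i)%N) -> (k <= l)%N).

Definition log2R (x : R) : R := (ln x / ln 2)%R.

(* Main.v *)
(** Give every [X] in [A] a label [w], initially 0, and require only that
    [w + |X ∩ Y|] lies in [M]. To eliminate a coordinate [v], keep the larger of
    the two halves of [B] on which membership of [v] is constant, delete [v] from
    the sets of [A], and add the lost contribution to their labels. Two labelled
    sets that become equal under this operation contribute [t] and [t + 1] (or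
    [t - 1]) against the *other* half of [B], so the collisions and that other
    half form an intersecting pair for [M ∩ (M - 1)] or [M ∩ (M + 1)], whose runs
    are shorter by one. Hence either the other half of [B] is negligible, and the
    collisions cost at most a factor 2 while [B] hardly shrinks, or the collisions
    are few by induction on [l], and [B] shrinks by at most a factor 2. This gives
    [(n + 2) C ^ n D ^ l] with [C] as close to 2 as desired, at the expense of [D]:
    [C = 2.6, D = 10 ^ 4] for the first bound and [C = 2 (1 + 1 / n), D = n (n + 1)]
    for the second. *)

Require Import Defs.
From mathcomp Require Import all_boot.
From mathcomp Require Import ssralg finalg zmodp.
From Stdlib Require Import Reals Lra.

Import GRing.Theory.

Set Implicit Arguments.
Unset Strict Implicit.
Unset Printing Implicit Defensive.

(** * Labelled families and the elimination of one coordinate *)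

Section LabelledFamilies.

Local Open Scope ring_scope.

Variables (V : finType) (G : finZmodType) (g : G).

(** The range [i <= l] excludes [l + 1] terms in a row, so [l] is an upper bound for the run length,
    not its exact value; [l = 0] makes [M] empty. *)
Definition run_free (l : nat) (M : pred G) : Prop :=
  forall a : G, ~ (forall i : nat, (i <= l)%nat -> M (a + g *+ i)).

Definition labelled_intersecting (M : pred G)
    (A : {set {set V} * G}) (B : {set {set V}}) : Prop :=
  forall p Y, p \in A -> Y \in B -> M (p.2 + g *+ #|p.1 :&: Y|).

Definition half (b : bool) (v : V) (B : {set {set V}}) : {set {set V}} :=
  [set Y in B | (v \in Y) == b].

Definition absorb (b : bool) (v : V) (p : {set V} * G) : {set V} * G :=
  (p.1 :\ v, (p.2 + g *+ (b && (v \in p.1)))).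

(** A collision is recorded by its member avoiding [v]; the shift by [g *+ b] is the one that makes
    [absorb b v] identify it with its partner containing [v]. *)
Definition collisions (b : bool) (v : V) (A : {set {set V} * G}) :
    {set {set V} * G} :=
  [set p in A | (v \notin p.1) && ((v |: p.1, (p.2 - g *+ b)) \in A)].

Lemma run_free_inter_succ l (M : pred G) : run_free l.+1 M ->
  run_free l [pred t | M t && M (t + g)].
Proof.
move=> hM a ha; apply: (hM a) => -[|i] hi.
  by have /andP[] := ha 0%nat (leq0n _).
by have /andP[_] := ha i hi; rewrite -addrA -mulrSr.
Qed.

Lemma run_free_inter_pred l (M : pred G) : run_free l.+1 M ->
  run_free l [pred t | M t && M (t - g)].
Proof.
move=> hM a ha; apply: (hM (a - g)) => -[|i] hi.
  by have /andP[_] := ha 0%nat (leq0n _); rewrite !mulr0n !addr0.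
by have /andP[] := ha i hi; rewrite mulrS addrA subrK.
Qed.

Lemma card_halves (v : V) (B : {set {set V}}) b :
  #|B| = (#|half b v B| + #|half (~~ b) v B|)%nat.
Proof.
rewrite -(cardsID [set Y : {set V} | (v \in Y) == b] B); congr (_ + _)%nat.
  by apply: eq_card => Y; rewrite !inE.
by apply: eq_card => Y; rewrite !inE andbC; case: b (v \in Y) => -[].
Qed.

Lemma cardsI_D1 (X Y : {set V}) (v : V) :
  #|X :&: Y| = (((v \in X) && (v \in Y)) + #|(X :\ v) :&: Y|)%nat.
Proof.
rewrite (cardsD1 v (X :&: Y)) inE; congr (_ + _)%nat.
by apply: eq_card => x; rewrite !inE andbA.
Qed.

Lemma absorb_notin b (v : V) (p : {set V} * G) : v \notin p.1 -> absorb b v p = p.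
Proof.
case: p => X w /= hv; rewrite /absorb /= (negPf hv) andbF mulr0n addr0.
by congr (_, _); apply/setP => x; rewrite !inE; case: eqP => [->|//]; rewrite (negPf hv).
Qed.

Lemma collisions_sub_absorb b (v : V) (A : {set {set V} * G}) :
  collisions b v A \subset absorb b v @: A.
Proof.
apply/subsetP => p; rewrite inE => /andP[pA /andP[hv _]].
by apply/imsetP; exists p; rewrite ?absorb_notin.
Qed.

(** Two distinct elements with the same image differ in whether they contain [v], and the one
    avoiding [v] is then a collision. So [absorb b v] is injective off the collisions. *)
Lemma card_absorb b (v : V) (A : {set {set V} * G}) :
  (#|A| <= #|absorb b v @: A| + #|collisions b v A|)%nat.
Proof.
rewrite -(cardsID (collisions b v A) A) addnC.
apply: leq_add; last by rewrite subset_leq_card // subsetIr.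
rewrite -(@card_in_imset _ _ (absorb b v) (A :\: collisions b v A)); last first.
  have key p q : p \in A :\: collisions b v A -> q \in A ->
    v \notin p.1 -> v \in q.1 -> absorb b v p = absorb b v q -> False.
    rewrite !inE => /andP[pC pA] qA vp vq e; case/negP: pC.
    rewrite pA vp /=; move: e; rewrite absorb_notin // => ->.
    by rewrite /absorb /= vq andbT addrK setD1K // -surjective_pairing.
  move=> p q hp hq e; have pA : p \in A by case/setDP: hp.
  have qA : q \in A by case/setDP: hq.
  case vp: (v \in p.1); case vq: (v \in q.1).
  - move: e; rewrite /absorb vp vq => -[e1 /addIr e2].
    rewrite (surjective_pairing p) (surjective_pairing q) e2.
    by rewrite -(setD1K vp) -(setD1K vq) e1.
  - by case: (key q p) => //; rewrite ?vq.
  - by case: (key p q) => //; rewrite ?vp.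
  - by move: e; rewrite !absorb_notin ?vp ?vq.
by rewrite subset_leq_card // imsetS // subsetDl.
Qed.

Lemma absorb_intersecting M A B b (v : V) : labelled_intersecting M A B ->
  labelled_intersecting M (absorb b v @: A) (half b v B).
Proof.
move=> h _ Y /imsetP[p pA ->]; rewrite inE => /andP[YB /eqP Yv] /=.
have := h p Y pA YB; rewrite (cardsI_D1 _ _ v) mulrnDr addrA.
by rewrite Yv [_ && b]andbC.
Qed.

(** A set [Y] of the opposite half contains [v] iff [b] is false. If [b] is true, the partner has
    its label lower by [g] and the same intersection with [Y]; otherwise the labels agree and the
    intersection gains [v]. *)
Lemma collisions_intersecting M A B b (v : V) : labelled_intersecting M A B ->
  labelled_intersecting [pred t | M t && M (if b then t - g else t + g)]
    (collisions b v A) (half (~~ b) v B).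
Proof.
move=> h p Y; rewrite !inE => /andP[pA /andP[vp qA]] /andP[YB /eqP Yv].
rewrite (h p Y pA YB) /=; have := h _ Y qA YB.
rewrite /= (cardsI_D1 _ _ v) setU11 setU1K // Yv.
by case: (b) => /=; [rewrite add0n mulr1n addrAC|rewrite mulr0n subr0 mulrS addrCA addrC].
Qed.

Lemma labelled_intersecting_run_free0 M A B :
  run_free 0 M -> labelled_intersecting M A B -> (A == set0) || (B == set0).
Proof.
move=> hM hAB; apply: contraT; rewrite negb_or => /andP[/set0Pn[p pA] /set0Pn[Y YB]].
case: (hM (p.2 + g *+ #|p.1 :&: Y|)) => i; rewrite leqn0 => /eqP ->.
by rewrite mulr0n addr0; exact: hAB.
Qed.

Lemma card_labelled_set0 (A : {set {set V} * G}) :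
  (forall p, p \in A -> p.1 \subset set0) -> (#|A| <= #|G|)%nat.
Proof.
move=> hA; rewrite -(@card_in_imset _ _ snd A) ?max_card //.
move=> [X w] [Y w'] /hA /= + /hA /=; rewrite !subset0 => /eqP -> /eqP -> -> //.
Qed.

End LabelledFamilies.

(* Labels are integers modulo [n + 2]: as [n + 1] is never in [M], no run of [M]
   wraps around, and there are only [n + 2] labels. *)
Section CyclicLabels.

Local Open Scope ring_scope.

Lemma val_Zp1_mulrn n k : val ((Zp1 : 'I_n.+2) *+ k) = (k %% n.+2)%nat.
Proof. by rewrite Zp_mulrn /= modnMml mul1n. Qed.

Lemma run_free_ord (n l : nat) (M : pred nat) :
  (forall k, M k -> (k <= n)%nat) -> length_is M l ->
  run_free (Zp1 : 'I_n.+2) l (fun x => M (val x)).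
Proof.
move=> hM [_ hl] a ha.
have valE i : val (a + Zp1 *+ i) = ((a + i) %% n.+2)%nat.
  by rewrite /= val_Zp1_mulrn modnDmr.
(* A run long enough to reach the residue [n + 1] has a term exceeding [n]; a shorter one is never
   reduced modulo [n + 2]. *)
have [hal|hal] := leqP (n.+1 - a) l.
  have := hM _ (ha _ hal); rewrite valE subnKC ?modn_small ?ltnn //.
  exact: ltn_ord a.
have /hl : forall i, (i < l.+1)%nat -> M (a + i)%nat; last by rewrite ltnn.
move=> i hi; have := ha i hi; rewrite valE modn_small //.
rewrite -ltn_subRL; apply: leq_trans hi (leq_trans hal _).
exact: leq_sub2r (leqnSn _).
Qed.

Lemma labelled_intersecting_ord (V : finType) (M : pred nat) (A B : {set {set V}}) :
  M_intersecting M A B ->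
  labelled_intersecting (Zp1 : 'I_#|V|.+2) (fun x => M (val x))
    [set (X, 0) | X in A] B.
Proof.
move=> hAB _ Y /imsetP[X XA ->] YB /=; rewrite add0n val_Zp1_mulrn modn_mod.
by rewrite modn_small ?hAB // ltnW // !ltnS max_card.
Qed.

End CyclicLabels.

(** * The recursive bound on the product of cardinalities *)

Section Bounds.

Local Open Scope R_scope.

(* [e] is the fraction of [b] below which the smaller half [b2] is negligible. *)
Lemma card_product_step (a a' c b b1 b2 C D e F : R) :
  0 <= a' -> 0 <= c -> 0 <= b1 -> 0 <= b2 -> 0 <= F -> 0 < D -> 0 < e < 1 ->
  2 <= C * (1 - e) -> 2 * e * D + 1 <= C * e * D ->
  b = b1 + b2 -> b2 <= b1 -> c <= a' -> a <= a' + c ->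
  a' * b1 <= D * F -> c * b2 <= F ->
  a * b <= C * (D * F).
Proof.
move=> ha' hc hb1 hb2 hF hD he hC1 hC2 -> hb ca' ha h1 h2.
have hC : 0 < C by nra.
have h0 : a * (b1 + b2) <= (a' + c) * (b1 + b2) by apply: Rmult_le_compat_r; lra.
apply: Rle_trans h0 _.
case: (Rle_lt_dec b2 (e * (b1 + b2))) => hb2e.
  have k1 : (a' + c) * (b1 + b2) <= 2 * (a' * (b1 + b2)) by nra.
  have k2 : 2 * (a' * (b1 + b2)) <= C * (1 - e) * (a' * (b1 + b2)).
    by apply: Rmult_le_compat_r => //; nra.
  have k3 : a' * ((1 - e) * (b1 + b2)) <= a' * b1 by apply: Rmult_le_compat_l; lra.
  nra.
(* Now [b2 > e b], so [c b <= F / e], while [a' b <= 2 a' b1 <= 2 D F]; the condition on [e D] makes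
   the sum fit. *)
have k1 : a' * (b1 + b2) <= 2 * (D * F) by nra.
have k2 : e * (c * (b1 + b2)) <= F by nra.
have k3 : e * ((a' + c) * (b1 + b2)) <= 2 * e * (D * F) + F by nra.
have k4 : (2 * e * D + 1) * F <= C * e * D * F by apply: Rmult_le_compat_r.
apply: (Rmult_le_reg_l e); lra.
Qed.

(** Induction on the size of [U], the set of coordinates not yet eliminated: sets of [A] lie in [U],
    while sets of [B] keep their eliminated coordinates but agree on them. Once [U] is empty, [B]
    has at most one member and only labels distinguish the members of [A]. [l] and [M] vary because
    collisions use a smaller [l]. *)
Lemma labelled_card_bound (V : finType) (G : finZmodType) (g : G) (C D e : R) :
  1 <= D -> 0 < e < 1 -> 2 <= C * (1 - e) -> 2 * e * D + 1 <= C * e * D ->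
  forall (U : {set V}) (l : nat) (M : pred G)
    (A : {set {set V} * G}) (B : {set {set V}}),
  (forall p, p \in A -> p.1 \subset U) ->
  {in B &, forall Y Z, Y :\: U = Z :\: U} ->
  run_free g l M -> labelled_intersecting g M A B ->
  INR #|A| * INR #|B| <= INR #|G| * C ^ #|U| * D ^ l.
Proof.
move=> hD he hC1 hC2 U.
have hC : 0 < C by nra.
have hF k l : 0 <= INR #|G| * C ^ k * D ^ l.
  by apply: Rmult_le_pos; [apply: Rmult_le_pos; [exact: pos_INR|]|]; apply: pow_le; lra.
elim: {U}#|U| {-2}U (erefl #|U|) => [|m IH] U hU l M A B hA hB hM hAB.
  have U0 : U = set0 by apply/eqP; rewrite -cards_eq0 hU.
  have hB1 : (#|B| <= 1)%nat.
    by apply/card_le1_eqP => Y Z YB ZB; have := hB Y Z YB ZB; rewrite U0 !setD0.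
  have hA1 : (#|A| <= #|G|)%nat by apply: card_labelled_set0 => p; rewrite -U0; exact: hA.
  rewrite hU /= Rmult_1_r.
  have /le_INR := elimT leP hA1; have /le_INR := elimT leP hB1.
  have := pow_R1_Rle D l hD; have := pos_INR #|A|; rewrite /=; nra.
have [v vU] : exists v : V, v \in U by apply/set0Pn; rewrite -card_gt0 hU.
have hU' : #|U :\ v| = m by move: hU; rewrite (cardsD1 v) vU => -[].
pose F l := INR #|G| * C ^ m * D ^ l.
have half_agree b : {in half b v B &, forall Y Z, Y :\: (U :\ v) = Z :\: (U :\ v)}.
  move=> Y Z; rewrite !inE => /andP[YB /eqP Yv] /andP[ZB /eqP Zv].
  apply/setP => x; have /setP/(_ x) := hB Y Z YB ZB; rewrite !inE.
  by case: eqP => [-> _|//]; rewrite Yv Zv.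
have absorb_sub b p : p \in absorb g b v @: A -> p.1 \subset U :\ v.
  by case/imsetP => q qA ->; exact: setSD (hA q qA).
have boundA b : INR #|absorb g b v @: A| * INR #|half b v B| <= F l.
  rewrite /F -hU'; apply: IH hU' _ _ _ _ (absorb_sub b) (half_agree b) hM _.
  exact: absorb_intersecting.
have [b hb] : exists b, (#|half (~~ b) v B| <= #|half b v B|)%nat.
  by case/orP: (leq_total #|half false v B| #|half true v B|) => h; [exists true|exists false].
case: l hM boundA => [|l] hM boundA.
  have /orP[/eqP ->|/eqP ->] := labelled_intersecting_run_free0 hM hAB;
    by rewrite cards0 /= ?Rmult_0_l ?Rmult_0_r; have := hF #|U| 0%nat.
have boundC : INR #|collisions g b v A| * INR #|half (~~ b) v B| <= F l.
  rewrite /F -hU'; apply: IH hU' _ _ _ _ _ (half_agree _) _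
    (collisions_intersecting (b := b) (v := v) hAB).
    move=> p /(subsetP (collisions_sub_absorb _ _ _ _)); exact: absorb_sub.
  by case: (b); [exact: run_free_inter_pred | exact: run_free_inter_succ].
have -> : INR #|G| * C ^ #|U| * D ^ l.+1 = C * (D * F l) by rewrite hU /F /=; ring.
apply: (@card_product_step _ (INR #|absorb g b v @: A|) (INR #|collisions g b v A|)
  _ (INR #|half b v B|) (INR #|half (~~ b) v B|) C D e) => //; try exact: pos_INR.
- exact: hF.
- lra.
- by rewrite (card_halves v B b) plus_INR.
- by apply/le_INR/leP.
- by apply/le_INR/leP/subset_leq_card/collisions_sub_absorb.
- by rewrite -plus_INR; apply/le_INR/leP/card_absorb.
- by have := boundA b; rewrite /F /=; lra.
Qed.

(** Initially no coordinate is eliminated and every label is 0; the factor [#|V| + 2] is the number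
    of labels. *)
Lemma M_intersecting_card_bound (V : finType) (M : pred nat) (l : nat)
    (A B : {set {set V}}) (C D e : R) :
  1 <= D -> 0 < e < 1 -> 2 <= C * (1 - e) -> 2 * e * D + 1 <= C * e * D ->
  (forall k : nat, M k -> (k <= #|V|)%nat) -> length_is M l ->
  M_intersecting M A B ->
  INR (#|A| * #|B|)%nat <= INR #|V|.+2 * C ^ #|V| * D ^ l.
Proof.
move=> hD he hC1 hC2 hM hl hAB; rewrite mult_INR.
rewrite -[in INR #|V|.+2](card_ord #|V|.+2) -[in C ^ _](cardsT V).
rewrite -(@card_imset _ _ (fun X => (X, GRing.zero : 'I_#|V|.+2))); last by move=> X Y [].
apply: (labelled_card_bound hD he hC1 hC2 _ _ (run_free_ord hM hl)
  (labelled_intersecting_ord hAB)) => [p _|Y Z _ _]; first exact: subsetT.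
by rewrite !setDT.
Qed.

(** * Numerical estimates for the two choices of constants *)

Lemma linear_lt_geometric (n : nat) :
  INR n.+2 * (13 / 5) ^ n < 10 ^ 10 * (2631 / 1000) ^ n.
Proof.
have -> : 2631 / 1000 = 13 / 5 * (1 + 31 / 2600) by field.
rewrite Rpow_mult_distr.
have h1 : 0 < (13 / 5) ^ n by apply: pow_lt; lra.
(* Bernoulli's inequality: the excess of 2.631 over 2.6 absorbs the linear factor. *)
have h2 : 1 + INR n * (31 / 2600) <= (1 + 31 / 2600) ^ n by apply: poly; lra.
have h3 : INR n.+2 < 10 ^ 10 * (1 + 31 / 2600) ^ n.
  by rewrite !S_INR; have := pos_INR n; lra.
have := Rmult_lt_compat_r _ _ _ h1 h3; lra.
Qed.

Lemma pow_1_plus_inv_le (n : nat) : (0 < n)%nat -> (1 + / INR n) ^ n <= 3.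
Proof.
move=> /ltP /lt_INR n0; apply: Rle_trans exp_le_3.
have hp := Rinv_0_lt_compat _ n0.
apply: Rle_trans (pow_incr _ (exp (/ INR n)) n _) _.
  by split; [lra|exact: exp_ineq1_le].
rewrite -Rpower_pow; last exact: exp_pos.
by rewrite /Rpower ln_exp Rinv_r; [exact: Rle_refl|apply: Rgt_not_eq].
Qed.

Lemma Rpower_log2R (x : R) : 0 < x -> Rpower 2 (log2R x) = x.
Proof.
move=> hx; have h2 : 0 < ln 2 by rewrite -ln_1; apply: ln_increasing; lra.
by rewrite /Rpower /log2R /Rdiv Rmult_assoc Rinv_l ?Rmult_1_r ?exp_ln //; lra.
Qed.

Lemma log2R_ge3 (x : R) : 8 <= x -> 3 <= log2R x.
Proof.
move=> hx; apply: Rnot_lt_le => h.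
have := Rpower_lt 2 _ _ ltac:(lra) h; rewrite Rpower_log2R; last lra.
have -> : 3 = INR 3 by rewrite /=; lra.
by rewrite Rpower_pow /=; lra.
Qed.

(** The right side is [2 ^ n] times [n ^ (2 l log n)], which is at least [n ^ (6 l)] as
    [log n >= 3]. Half of these powers dominates [(n (n + 1)) ^ l], the other half [3 (n + 2)],
    where 3 bounds [(1 + 1 / n) ^ n]. *)
Lemma polynomial_factor_bound (n l : nat) : (8 <= n)%nat -> (0 < l)%nat ->
  INR n.+2 * (2 * (1 + / INR n)) ^ n * (INR n * (INR n + 1)) ^ l <
  Rpower 2 (INR n + 2 * INR l * log2R (INR n) ^ 2).
Proof.
move=> n8 l0; set x := INR n.
have hx : 8 <= x by have := le_INR _ _ (elimT leP n8); rewrite /x /=; lra.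
have hl : 1 <= INR l by have := le_INR _ _ (elimT leP l0).
have hL := log2R_ge3 hx.
rewrite Rpower_plus Rpower_pow; last lra.
have -> : 2 * INR l * log2R x ^ 2 = log2R x * (2 * INR l * log2R x) by ring.
rewrite -Rpower_mult Rpower_log2R; last lra.
apply: (Rlt_le_trans _ (2 ^ n * x ^ (6 * l))); last first.
  apply: Rmult_le_compat_l; first by apply: pow_le; lra.
  rewrite -Rpower_pow; last lra.
  apply: Rle_Rpower; first lra.
  by rewrite mult_INR /=; nra.
have -> : (6 * l = 3 * l + 3 * l)%nat by rewrite -mulnDl.
rewrite Rpow_mult_distr pow_add.
have p2 : 0 < 2 ^ n by apply: pow_lt; lra.
have pe : 0 < (1 + / x) ^ n.
  by apply: pow_lt; have := Rinv_0_lt_compat x; lra.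
have h3 : (1 + / x) ^ n <= 3 by apply: pow_1_plus_inv_le; exact: leq_trans n8.
have hq : (x * (x + 1)) ^ l <= x ^ (3 * l).
  by rewrite pow_mult; apply: pow_incr => /=; nra.
have hq0 : 0 < (x * (x + 1)) ^ l by apply: pow_lt; nra.
have hr : 3 * INR n.+2 < x ^ (3 * l).
  apply: (Rlt_le_trans _ (x ^ 3)).
    by rewrite !S_INR -/x /=; nra.
  by apply: Rle_pow; [lra|apply/leP; rewrite leq_pmulr].
have hn : 0 < INR n.+2 by rewrite !S_INR -/x; lra.
have k1 : INR n.+2 * (1 + / x) ^ n < x ^ (3 * l) by nra.
have k2 : INR n.+2 * (1 + / x) ^ n * (x * (x + 1)) ^ l < x ^ (3 * l) * x ^ (3 * l).
  apply: (Rlt_le_trans _ (x ^ (3 * l) * (x * (x + 1)) ^ l)).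
    exact: Rmult_lt_compat_r.
  by apply: Rmult_le_compat_l => //; apply: pow_le; lra.
have := Rmult_lt_compat_l _ _ _ p2 k2; lra.
Qed.

End Bounds.

(** For [l = 0] the second bound is just [2 ^ n], with no room for the factor [n + 2], so this case
    is treated apart. *)
Lemma M_intersecting_length0 (V : finType) (M : pred nat) (A B : {set {set V}}) :
  length_is M 0 -> M_intersecting M A B -> (#|A| * #|B| = 0)%N.
Proof.
move=> [_ hl] hAB; apply/eqP; rewrite muln_eq0 !cards_eq0.
apply: contraT; rewrite negb_or => /andP[/set0Pn[X XA] /set0Pn[Y YB]].
have := hl #|X :&: Y| 1%N; apply=> -[|//] _; rewrite addn0; exact: hAB.
Qed.

Theorem theorem2 :
  (forall (n : nat) (V : finType) (M : pred nat) (l : nat) (A B : {set {set V}}),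
      (1 <= n)%N -> #|V| = n ->
      (forall k : nat, M k -> (k <= n)%N) ->
      length_is M l ->
      M_intersecting M A B ->
      (INR (#|A| * #|B|) < (2631 / 1000) ^ n * 10 ^ (4 * l + 10)%nat)%R)
  /\
  (exists N : nat,
      forall (n : nat) (V : finType) (M : pred nat) (l : nat) (A B : {set {set V}}),
        (N <= n)%N -> #|V| = n ->
        (forall k : nat, M k -> (k <= n)%N) ->
        length_is M l ->
        M_intersecting M A B ->
        (INR (#|A| * #|B|) < Rpower 2 (INR n + 2 * INR l * (log2R (INR n)) ^ 2))%R).
Proof.
split=> [n V M l A B _ <- hM hl hAB|].
  (* Here [C (1 - e) = 2.08] and [(C - 2) e D = 1200], which meets both conditions. *)
  apply: Rle_lt_trans (M_intersecting_card_bound (C := 13 / 5) (D := 10 ^ 4) (e := / 5)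
    _ _ _ _ hM hl hAB) _; try lra.
  rewrite pow_add pow_mult.
  have h := linear_lt_geometric #|V|.
  have h4 : (0 < (10 ^ 4) ^ l)%R by apply: pow_lt; lra.
  have := Rmult_lt_compat_r _ _ _ h4 h; lra.
(* The threshold is [2 ^ 3], from which on the binary logarithm is at least 3. *)
exists 8%N => n V M [|l] A B n8 cV hM hl hAB.
  by rewrite (M_intersecting_length0 hl hAB); exact: exp_pos.
apply: Rle_lt_trans (polynomial_factor_bound n8 (ltn0Sn l)).
have hx : (8 <= INR n)%R by have := le_INR _ _ (elimT leP n8); rewrite /=; lra.
rewrite -cV in hM hx *; set x := INR _ in hx *.
(* With [C = 2 (1 + 1 / n)] this [e] gives [C (1 - e) = 2] exactly, and [D = n (n + 1)] gives
   [(C - 2) e D = 2]. *)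
apply: (M_intersecting_card_bound (e := / (x + 1)) _ _ _ _ hM hl hAB).
- nra.
- split; first by apply: Rinv_0_lt_compat; lra.
  by rewrite -Rinv_1; apply: Rinv_lt_contravar; lra.
- by apply: Req_le; field; lra.
- have -> : (2 * / (x + 1) * (x * (x + 1)) + 1 = 2 * x + 1)%R by field; lra.
  have -> : (2 * (1 + / x) * / (x + 1) * (x * (x + 1)) = 2 * x + 2)%R by field; lra.
  lra.
Qed.
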